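(* Let $G$ be a twin-free weighted graph. For every integer $k\ge 0$, let $\mathrm{orb}_k(G)$ denote the number of orbits of the automorphism group $\mathrm{Aut}(G)$ acting on ordered $k$-tuples of nodes of $G$ (i.e. on $V(G)^k$), and let $M(k,G)$ be the $k$-th connection matrix for homomorphisms into $G$. Then $\mathrm{rk}(M(k,G))=\mathrm{orb}_k(G)$ for every $k$.
   Context: A weighted graph $G$ consists of a finite node set $V(G)$, a positive real weight $\alpha_G(i)$ for each node $i$, and a real weight $\beta_{ij}=\beta_G(i,j)=\beta_G(j,i)$ for each pair of nodes $i,j$ (including loops $i=j$; a missing edge is the same as an edge of weight $0$). Two nodes $i,j\in V(G)$ are twins if $\beta_{il}=\beta_{jl}$ for every $l\in V(G)$ (including $l=i$ and $l=j$; node weights play no role). $G$ is twin-free if no two different nodes are twins. An automorphism of $G$ is a permutation $\sigma$ of $V(G)$ preserving node weights and edge weights: $\alpha_G(\sigma(i))=\alpha_G(i)$ and $\beta_{\sigma(i)\sigma(j)}=\beta_{ij}$ for all $i,j$. The group $\mathrm{Aut}(G)$ acts on $k$-tuples coordinatewise. For a finite unweighted graph $F$ (multiple edges allowed, no loops), define $$\hom(F,G)=\sum_{\phi:V(F)\to V(G)}\ \prod_{u\in V(F)}\alpha_G(\phi(u))\prod_{uv\in E(F)}\beta_G(\phi(u),\phi(v)),$$ where edges are taken with multiplicity. A $k$-labeled graph is a finite graph (multiple edges allowed, no loops) in which $k$ distinct nodes are labeled $1,\dots,k$ (with any number of unlabeled nodes); isomorphisms of $k$-labeled graphs preserve labels.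 The product $F_1F_2$ of two $k$-labeled graphs is obtained by taking their disjoint union and identifying nodes with the same label (keeping all edges, so multiple edges may arise); for $k=0$ it is the disjoint union. The connection matrix $M(k,G)$ is the infinite real matrix whose rows and columns are indexed by isomorphism types of $k$-labeled graphs and whose $(F_1,F_2)$ entry is $\hom(F_1F_2,G)$. Its rank is the dimension of the linear span of its columns. *)

(* Defs.v *)
From HB Require Import structures.
From mathcomp Require Import all_boot all_order all_algebra all_fingroup all_solvable.
From mathcomp Require Import boolp classical_sets functions reals.

Set Implicit Arguments.
Unset Strict Implicit.
Unset Printing Implicit Defensive.

Import Order.TTheory GRing.Theory Num.Theory.
Local Open Scope ring_scope.
Local Open Scope quotient_scope.

Record wgraph (R : realType) := WGraph {
  wnode :> finType;
  nodew : wnode -> R;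
  edgew : wnode -> wnode -> R;
  nodew_gt0 : forall i, 0 < nodew i;
  edgewC : forall i j, edgew i j = edgew j i }.

Arguments nodew {R} w i.
Arguments edgew {R} w i j.

Section WeightedGraph.
Variables (R : realType) (G : wgraph R).

Definition twins (i j : G) : Prop := forall l : G, edgew G i l = edgew G j l.

Definition twin_free : Prop := forall i j : G, twins i j -> i = j.

Definition wg_Aut : {set {perm G}} :=
  [set s : {perm G} | [forall i, nodew G (s i) == nodew G i]
                   && [forall i, [forall j, edgew G (s i) (s j) == edgew G i j]]].

Fact wg_Aut_group_set : group_set wg_Aut.
Proof.
apply/group_setP; split=> [|s t].
  rewrite inE; apply/andP; split; apply/forallP=> i; first by rewrite perm1.
  by apply/forallP=> j; rewrite !perm1.
rewrite !inE => /andP[/forallP sa /forallP sb] /andP[/forallP ta /forallP tb].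
apply/andP; split; apply/forallP=> i.
  by rewrite permM (eqP (ta _)) sa.
apply/forallP=> j; rewrite !permM (eqP (forallP (tb _) _)).
exact: (forallP (sb _)).
Qed.

Canonical wg_Aut_group := Group wg_Aut_group_set.

Definition orb (k : nat) : nat :=
  #|orbit ('P * k)%act wg_Aut @: [set: k.-tuple G]|.

End WeightedGraph.

(* Finite multigraphs without loops on V: the list of edges, with              *)
(* multiplicities. The order of the list and the orientation of the pairs are  *)
(* irrelevant: hom only uses the symmetric edgew, and isomorphisms only see    *)
(* the multiset [ends F] of unordered pairs.                                   *)
Record mgraph (V : finType) := MGraph {
  edges : seq (V * V);
  edges_loopless : all (fun e => e.1 != e.2) edges }.

HB.instance Definition _ (V : finType) := [isSub for @edges V].
HB.instance Definition _ (V : finType) := [Choice of mgraph V by <:].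

Definition ends (V : finType) (F : mgraph V) : seq {set V} :=
  [seq [set e.1; e.2] | e <- edges F].

Definition hom (R : realType) (V : finType) (F : mgraph V) (G : wgraph R) : R :=
  \sum_(phi : {ffun V -> G})
     (\prod_(u : V) nodew G (phi u)) *
     (\prod_(e <- edges F) edgew G (phi e.1) (phi e.2)).

(* k-labeled graphs: [inl i] is the node labeled i, and the [inr j] are the n  *)
(* unlabeled nodes. Up to isomorphism this covers all finite k-labeled graphs, *)
(* and keeps them in a small type.                                             *)
Definition lnode (k n : nat) : finType := ('I_k + 'I_n)%type.

Definition lgraph (k : nat) := {n : nat & mgraph (lnode k n)}.
HB.instance Definition _ k := Choice.on (lgraph k).

Definition liso (k : nat) (F1 F2 : lgraph k) : Prop :=
  exists f : lnode k (tag F1) -> lnode k (tag F2),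
    [/\ bijective f,
        forall i : 'I_k, f (inl i) = inl i
      & perm_eq [seq f @: e | e : {set _} <- ends (tagged F1)]
                (ends (tagged F2))].

Definition lisob (k : nat) : rel (lgraph k) := fun F1 F2 => `[< liso F1 F2 >].

Fact lisob_refl k : reflexive (@lisob k).
Proof.
move=> F; apply/asboolP; exists id; split=> //; first by exists id.
by rewrite (eq_map (@imset_id _)) map_id.
Qed.

Fact liso_sym k (F1 F2 : lgraph k) : liso F1 F2 -> liso F2 F1.
Proof.
move=> [f [[g fK gK] fl pf]]; exists g; split; first by exists f.
  by move=> i; rewrite -[inl i]fl fK.
rewrite perm_sym in pf.
apply: perm_trans (perm_map (fun e : {set _} => g @: e) pf) _.
rewrite -map_comp -[X in perm_eq _ X]map_id.
rewrite (eq_map (g := id)) // => e /=.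
by rewrite -imset_comp (eq_imset _ fK) imset_id.
Qed.

Fact lisob_sym k : symmetric (@lisob k).
Proof. by move=> F1 F2; apply/asboolP/asboolP; exact: liso_sym. Qed.

Fact lisob_trans k : transitive (@lisob k).
Proof.
move=> F2 F1 F3 /asboolP[f [bf fl pf]] /asboolP[g [bg gl pg]].
apply/asboolP; exists (g \o f); split; first exact: bij_comp.
  by move=> i /=; rewrite fl gl.
apply: perm_trans pg.
have := perm_map (fun e : {set _} => g @: e) pf.
rewrite -map_comp; congr (is_true (perm_eq _ _)).
by apply: eq_map => e; rewrite [RHS]imset_comp.
Qed.

Canonical lisob_equiv k :=
  EquivRel (@lisob k) (@lisob_refl k) (@lisob_sym k) (@lisob_trans k).

Definition isotype (k : nat) := {eq_quot (@lisob k)}.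
HB.instance Definition _ k := Choice.on (isotype k).
HB.instance Definition _ k := EqQuotient.on (isotype k).

Section Product.
Variables (k n1 n2 : nat).

Definition emb1 (x : lnode k n1) : lnode k (n1 + n2) :=
  match x with inl i => inl i | inr j => inr (lshift n2 j) end.

Definition emb2 (x : lnode k n2) : lnode k (n1 + n2) :=
  match x with inl i => inl i | inr j => inr (rshift n1 j) end.

Lemma emb1_inj : injective emb1.
Proof.
case=> [i|i] [j|j] //= [e]; first by rewrite e.
by congr inr; apply: val_inj.
Qed.

Lemma emb2_inj : injective emb2.
Proof.
case=> [i|i] [j|j] //= [e]; first by rewrite e.
by congr inr; apply: val_inj; apply: (addnI e).
Qed.

Definition glue_edges (F1 : mgraph (lnode k n1)) (F2 : mgraph (lnode k n2)) :=
  [seq (emb1 e.1, emb1 e.2) | e <- edges F1] ++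
  [seq (emb2 e.1, emb2 e.2) | e <- edges F2].

Fact glue_loopless F1 F2 : all (fun e => e.1 != e.2) (glue_edges F1 F2).
Proof.
rewrite all_cat !all_map; apply/andP; split.
  by apply: sub_all (edges_loopless F1) => e /=; rewrite (inj_eq emb1_inj).
by apply: sub_all (edges_loopless F2) => e /=; rewrite (inj_eq emb2_inj).
Qed.

Definition glue_mgraph F1 F2 : mgraph (lnode k (n1 + n2)) :=
  MGraph (glue_loopless F1 F2).

End Product.

Definition glue (k : nat) (F1 F2 : lgraph k) : lgraph k :=
  Tagged (fun n => mgraph (lnode k n)) (glue_mgraph (tagged F1) (tagged F2)).

(* [conn_mxE] below: the entries do not depend on the representatives. *)
Definition conn_mx (R : realType) (k : nat) (G : wgraph R)
    (x y : isotype k) : R :=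
  hom (tagged (glue (generic_quotient.repr x) (generic_quotient.repr y))) G.

Section Rank.
Variable R : realType.

Definition lin_span (V : lmodType R) (S : set V) : set V :=
  fun v => exists (n : nat) (c : 'I_n -> R) (w : 'I_n -> V),
    (forall i, S (w i)) /\ v = \sum_(i < n) c i *: w i.

Definition lin_indep (V : lmodType R) (d : nat) (b : 'I_d -> V) : Prop :=
  forall c : 'I_d -> R, \sum_(i < d) c i *: b i = 0 -> forall i, c i = 0.

(* [has_dim_unique] below: such a d is unique. *)
Definition has_dim (V : lmodType R) (U : set V) (d : nat) : Prop :=
  exists b : 'I_d -> V, lin_indep b /\ U = lin_span (range b)%classic.

Definition has_rank (I J : Type) (M : I -> J -> R) (d : nat) : Prop :=
  has_dim (lin_span (range (fun (j : J) (i : I) => M i j : R^o))%classic) d.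

End Rank.

Lemma lin_span_range (R : realType) (V : lmodType R) d (b : 'I_d -> V) (v : V) :
  lin_span (range b)%classic v -> exists c : 'I_d -> R, v = \sum_i c i *: b i.
Proof.
move=> [n [c [w [Sw ->]]]].
have /choice[g gE] : forall i, exists j, b j = w i.
  by move=> i; have [j _ <-] := Sw i; exists j.
exists (fun j => \sum_(i | g i == j) c i).
rewrite (partition_big g predT) //=; apply: eq_bigr => j _.
by rewrite scaler_suml; apply: eq_bigr => i /eqP <-; rewrite gE.
Qed.

Lemma has_dim_unique (R : realType) (V : lmodType R) (U : set V) d1 d2 :
  has_dim U d1 -> has_dim U d2 -> d1 = d2.
Proof.
suff le : forall e1 e2, has_dim U e1 -> has_dim U e2 -> (e1 <= e2)%N.
  by move=> h1 h2; apply/eqP; rewrite eqn_leq !le.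
move=> {d1 d2} d1 d2 [b1 [i1 U1]] [b2 [i2 U2]].
have /choice[A AE] : forall i, exists c : 'I_d2 -> R, b1 i = \sum_j c j *: b2 j.
  move=> i; apply: lin_span_range; rewrite -U2 U1.
  exists 1%N, (fun=> 1), (fun=> b1 i); split; first by move=> _; exists i.
  by rewrite big_ord1 scale1r.
pose M : 'M[R]_(d1, d2) := \matrix_(i, j) A i j.
suff /eqP <- : \rank M == d1 by exact: rank_leq_col.
rewrite -[_ == _]/(row_free M) -kermx_eq0; apply/eqP/matrixP => r i.
rewrite [RHS]mxE; apply: (i1 (fun i => kermx M r i)).
under eq_bigr do rewrite AE scaler_sumr.
rewrite exchange_big big1 //= => j _.
under eq_bigr do rewrite scalerA.
rewrite -scaler_suml (_ : \sum_i _ = (kermx M *m M) r j); last first.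
  by rewrite [RHS]mxE; apply: eq_bigr => l _; rewrite [M l j]mxE.
by rewrite mulmx_ker mxE scale0r.
Qed.

Lemma hom_iso (R : realType) (G : wgraph R) k (F1 F2 : lgraph k) :
  liso F1 F2 -> hom (tagged F1) G = hom (tagged F2) G.
Proof.
move=> [f [[g fK gK] _ pf]]; rewrite /hom.
rewrite (reindex (fun psi : {ffun lnode k (tag F2) -> G} => [ffun x => psi (f x)])) /=.
  apply: eq_bigr => psi _; congr (_ * _).
    rewrite [RHS](reindex f) /=; last by exists g => x _; [exact: fK|exact: gK].
    by apply: eq_bigr => u _; rewrite ffunE.
  pose h (A : {set lnode k (tag F2)}) : R :=
    if [pick p | A == [set p.1; p.2]] is Some p
    then edgew G (psi p.1) (psi p.2) else 1.
  have hE x y : h [set x; y] = edgew G (psi x) (psi y).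
    rewrite /h; case: pickP => [[u v] /= /eqP/setP E|/(_ (x, y))]; last by rewrite eqxx.
    have := E x; have := E y; have := E u; have := E v; rewrite !inE !eqxx ?orbT /=.
    move=> /orP[]/eqP-> /orP[]/eqP-> //; rewrite ?eqxx ?orbb.
    - by move=> /esym/eqP->.
    - by rewrite edgewC.
    - by move=> _ /esym/eqP->.
  transitivity (\prod_(A <- ends (tagged F2)) h A); last first.
    by rewrite big_map; apply: eq_bigr => e _; rewrite hE.
  rewrite -(perm_big _ pf) /= !big_map; apply: eq_bigr => e _.
  by rewrite imsetU !imset_set1 hE !ffunE.
exists (fun phi : {ffun lnode k (tag F1) -> G} => [ffun x => phi (g x)]) => phi _.
  by apply/ffunP => x; rewrite !ffunE gK.
by apply/ffunP => x; rewrite !ffunE fK.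
Qed.

Section GlueMap.
Variables (k n1 n2 m1 m2 : nat).
Variables (f1 : lnode k n1 -> lnode k m1) (f2 : lnode k n2 -> lnode k m2).
Hypotheses (f1l : forall i : 'I_k, f1 (inl i) = inl i) (f2l : forall i : 'I_k, f2 (inl i) = inl i).

Definition glue_map (x : lnode k (n1 + n2)) : lnode k (m1 + m2) :=
  match x with
  | inl i => inl i
  | inr j => match fintype.split j with
             | inl j1 => emb1 m2 (f1 (inr j1))
             | inr j2 => emb2 m1 (f2 (inr j2))
             end
  end.

Lemma glue_map1 x : glue_map (emb1 n2 x) = emb1 m2 (f1 x).
Proof. by case: x => [i|j] /=; rewrite ?f1l // (unsplitK (inl j)). Qed.

Lemma glue_map2 x : glue_map (emb2 n1 x) = emb2 m1 (f2 x).
Proof. by case: x => [i|j] /=; rewrite ?f2l // (unsplitK (inr j)). Qed.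

End GlueMap.

Lemma glue_mapK k n1 n2 m1 m2
    (f1 : lnode k n1 -> lnode k m1) (f2 : lnode k n2 -> lnode k m2) g1 g2 :
  (forall i, g1 (inl i) = inl i) -> (forall i, g2 (inl i) = inl i) ->
  cancel f1 g1 -> cancel f2 g2 -> cancel (glue_map f1 f2) (glue_map g1 g2).
Proof.
move=> g1l g2l K1 K2 [i|j] //=.
by case: (fintype.splitP j) => j' jE;
  rewrite (glue_map1, glue_map2) // (K1, K2) /=; congr inr; apply: val_inj.
Qed.

Lemma liso_glue k (F1 F2 H1 H2 : lgraph k) :
  liso F1 H1 -> liso F2 H2 -> liso (glue F1 F2) (glue H1 H2).
Proof.
move=> [f1 [[g1 f1K g1K] f1l pf1]] [f2 [[g2 f2K g2K] f2l pf2]].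
have g1l i : g1 (inl i) = inl i by rewrite -[inl i]f1l f1K.
have g2l i : g2 (inl i) = inl i by rewrite -[inl i]f2l f2K.
exists (glue_map f1 f2); split=> //.
  by exists (glue_map g1 g2); apply: glue_mapK.
rewrite /ends /= /glue_edges !map_cat; apply: perm_cat.
- have := perm_map (fun e : {set _} => @emb1 k (tag H1) (tag H2) @: e) pf1.
  rewrite /ends -!map_comp => pe; apply: etrans pe; congr (perm_eq _ _);
  by apply: eq_map => e /=; rewrite !imsetU !imset_set1 ?glue_map1.
- have := perm_map (fun e : {set _} => @emb2 k (tag H1) (tag H2) @: e) pf2.
  rewrite /ends -!map_comp => pe; apply: etrans pe; congr (perm_eq _ _);
  by apply: eq_map => e /=; rewrite !imsetU !imset_set1 ?glue_map2.
Qed.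

Lemma conn_mxE (R : realType) k (G : wgraph R) (F1 F2 : lgraph k) :
  conn_mx G (\pi_(isotype k) F1) (\pi_(isotype k) F2)
  = hom (tagged (glue F1 F2)) G.
Proof.
have reprP (F : lgraph k) : liso (generic_quotient.repr (\pi_(isotype k) F)) F.
  apply/asboolP; rewrite -[`[< _ >]]/(lisob_equiv k _ _).
  by apply/eqmodP; rewrite reprK.
by rewrite /conn_mx; apply: hom_iso; apply: liso_glue.
Qed.

(* Main.v *)
From mathcomp Require Import all_boot all_order all_algebra all_fingroup all_solvable.
From mathcomp Require Import boolp classical_sets functions reals.
Require Import Defs.

(** For a k-tuple [t] of nodes of [G] and a k-labeled graph [F], let [lhom t F]
be the weighted number of homomorphisms sending the label [i] to [t_i]
(without the weights of the [t_i] themselves).  Gluing multiplies these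
numbers, hence
    [hom (F1 F2, G) = sum_t tweight t * lhom t F1 * lhom t F2]
with positive [tweight].  The connection matrix is thus the Gram matrix of the
vectors [lhom _ F], for a positive definite form on the functions on k-tuples,
and its rank is the dimension of their span ([graphfun]).  It remains to see
that this span consists of the functions constant on the orbits of the
automorphism group.

The span is a subalgebra: it is closed under products because of gluing.  By
interpolation it contains the indicators of the classes of the relation
[indist], where two tuples are related when no graph tells them apart
([graphfun_class]).  Automorphic tuples are clearly indistinguishable; the
point is the converse ([indist_Aut]).

Erasing the label of one node of a (k+1)-labeled graph amounts to summing
over the values of this label, so sums over one coordinate go from functions
of (k+1)-tuples in the span to functions of k-tuples in the span.  Applied to
the indicator of a class, this gives the back-and-forth property
[indist_extend]: if [t] and [u] are indistinguishable, then any extension of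
[t] by a node is matched by one of [u].  Single edges show that
indistinguishable tuples have the same edge weights between different
positions, and back-and-forth turns this into: if [t_i = t_j], then [u_i] and
[u_j] are twins, hence equal ([indist_eq]).  So, after an extension that makes
[t] list all nodes of [G], the map sending [t_i] to [u_i] is a well-defined
injection.  It preserves edge weights, and node weights because the sum above,
over a class that pins down the new node, is the weight of that node. *)

(** * Homomorphisms with prescribed values on the labels *)

Section ConnectionRank.

Set Implicit Arguments.
Unset Strict Implicit.
Unset Printing Implicit Defensive.

Import Order.TTheory GRing.Theory Num.Theory.
Local Open Scope ring_scope.

Variables (R : realType) (G : wgraph R).

Definition labmap k n (t : k.-tuple G) (psi : 'I_n -> G) (x : lnode k n) : G :=
  match x with inl i => tnth t i | inr j => psi j end.

Definition lhom k (t : k.-tuple G) (F : lgraph k) : R :=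
  \sum_(psi : {ffun 'I_(tag F) -> G})
     (\prod_j nodew G (psi j)) *
     \prod_(e <- edges (tagged F))
        edgew G (labmap t psi e.1) (labmap t psi e.2).

Definition tweight k (t : k.-tuple G) : R := \prod_i nodew G (tnth t i).

Lemma tweight_gt0 k (t : k.-tuple G) : 0 < tweight t.
Proof. by apply: prodr_gt0 => i _; apply: nodew_gt0. Qed.

Lemma hom_lhom k (F : lgraph k) :
  hom (tagged F) G = \sum_t tweight t * lhom t F.
Proof.
under [RHS]eq_bigr do rewrite mulr_sumr.
rewrite pair_big /hom /=.
rewrite (reindex (fun p : k.-tuple G * {ffun 'I_(tag F) -> G} =>
  [ffun x => labmap p.1 p.2 x])) /=.
  apply: eq_bigr => -[t psi] _ /=; rewrite mulrA big_sumType /=.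
  congr (_ * _ * _); try by apply: eq_bigr => i _; rewrite ffunE.
  by apply: eq_bigr => e _; rewrite !ffunE.
exists (fun phi : {ffun lnode k (tag F) -> G} =>
  ([tuple phi (inl i) | i < k], [ffun j => phi (inr j)])) => [[t psi]|phi] _ /=.
  congr (_, _); first by apply: eq_from_tnth => i; rewrite tnth_mktuple ffunE.
  by apply/ffunP => j; rewrite !ffunE.
by apply/ffunP => -[i|j]; rewrite !ffunE /= ?tnth_mktuple ?ffunE.
Qed.

Lemma lhom_glue k (t : k.-tuple G) (F1 F2 : lgraph k) :
  lhom t (glue F1 F2) = lhom t F1 * lhom t F2.
Proof.
rewrite /lhom mulr_suml; under [RHS]eq_bigr do rewrite mulr_sumr.
rewrite pair_big /=.
rewrite (reindex (fun p : {ffun 'I_(tag F1) -> G} * {ffun 'I_(tag F2) -> G} =>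
  [ffun j : 'I_(tag F1 + tag F2) =>
     match fintype.split j with inl i => p.1 i | inr i => p.2 i end])) /=.
  apply: eq_bigr => -[p1 p2] _ /=; rewrite big_split_ord /= big_cat !big_map /=.
  set phi := [ffun j => _].
  have phi1 j : phi (lshift _ j) = p1 j by rewrite ffunE (unsplitK (inl j)).
  have phi2 j : phi (rshift _ j) = p2 j by rewrite ffunE (unsplitK (inr j)).
  have lab1 x : labmap t phi (emb1 _ x) = labmap t p1 x by case: x => [i|j] /=.
  have lab2 x : labmap t phi (emb2 _ x) = labmap t p2 x by case: x => [i|j] /=.
  rewrite mulrACA; congr (_ * _ * (_ * _)); apply: eq_bigr => e _;
    by rewrite ?phi1 ?phi2 ?lab1 ?lab2.
exists (fun phi : {ffun 'I_(tag F1 + tag F2) -> G} =>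
  ([ffun j => phi (lshift _ j)], [ffun j => phi (rshift _ j)])) => [[p1 p2]|phi] _ /=.
  by congr (_, _); apply/ffunP => j;
    rewrite !ffunE ?(unsplitK (inl j)) ?(unsplitK (inr j)).
apply/ffunP => j; rewrite !ffunE /=.
by rewrite -[in RHS](splitK j); case: fintype.split => i; rewrite ffunE.
Qed.

Lemma hom_glue k (F1 F2 : lgraph k) :
  hom (tagged (glue F1 F2)) G = \sum_t tweight t * lhom t F1 * lhom t F2.
Proof. by rewrite hom_lhom; apply: eq_bigr => t _; rewrite lhom_glue mulrA. Qed.

(** Isomorphic graphs give the same function of [t], because their difference
has norm zero for the Gram form: its inner products are entries of the
connection matrix, which only see isomorphism types. *)
Lemma lhom_repr k (t : k.-tuple G) (F : lgraph k) :
  lhom t (generic_quotient.repr (\pi_(isotype k)%qT F)) = lhom t F.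
Proof.
set F' := generic_quotient.repr _.
have pF' : \pi_(isotype k)%qT F' = \pi_(isotype k)%qT F by rewrite /F' generic_quotient.reprK.
have E (H1 H2 : lgraph k) :
    \sum_t tweight t * lhom t H1 * lhom t H2
    = conn_mx G (\pi_(isotype k)%qT H1) (\pi_(isotype k)%qT H2).
  by rewrite conn_mxE hom_glue.
have /psumr_eq0P : \sum_t tweight t * (lhom t F' - lhom t F) ^+ 2 = 0.
  transitivity (\sum_t tweight t * lhom t F' * lhom t F' -
    \sum_t tweight t * lhom t F * lhom t F' -
    (\sum_t tweight t * lhom t F' * lhom t F - \sum_t tweight t * lhom t F * lhom t F)).
    rewrite -!sumrB; apply: eq_bigr => u _.
    by rewrite expr2 mulrA !mulrBr !mulrBl.
  by rewrite !E !pF' !subrr.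
move=> /(_ _ t isT) H; apply/eqP; rewrite -subr_eq0 -sqrf_eq0.
have /eqP := H (fun u _ => mulr_ge0 (ltW (tweight_gt0 u)) (sqr_ge0 _)).
by rewrite mulf_eq0 gt_eqF ?tweight_gt0.
Qed.

(** * The algebra spanned by labeled graphs *)

(** The span of the functions [lhom _ F]; its elements are the evaluations of
formal linear combinations of graphs, also known as quantum graphs. *)
Definition graphfun k (f : k.-tuple G -> R) : Prop :=
  exists s : seq (R * lgraph k), forall t, f t = \sum_(p <- s) p.1 * lhom t p.2.

Lemma graphfun_lhom k (F : lgraph k) : graphfun (fun t => lhom t F).
Proof. by exists [:: (1, F)] => t; rewrite big_seq1 mul1r. Qed.

Lemma graphfunD k (f g : k.-tuple G -> R) :
  graphfun f -> graphfun g -> graphfun (fun t => f t + g t).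
Proof. by move=> [s fE] [r gE]; exists (s ++ r) => t; rewrite big_cat /= fE gE. Qed.

Lemma graphfunZ k c (f : k.-tuple G -> R) :
  graphfun f -> graphfun (fun t => c * f t).
Proof.
move=> [s fE]; exists [seq (c * p.1, p.2) | p <- s] => t.
by rewrite fE mulr_sumr big_map; apply: eq_bigr => p _; rewrite mulrA.
Qed.

Lemma graphfun_sum k I (r : seq I) (f : I -> k.-tuple G -> R) :
  (forall i, graphfun (f i)) -> graphfun (fun t => \sum_(i <- r) f i t).
Proof.
move=> gf; elim: r => [|i r [s sE]]; first by exists [::] => t; rewrite !big_nil.
have [s' s'E] := graphfunD (gf i) (ex_intro _ s sE).
by exists s' => t; rewrite big_cons s'E.
Qed.

Lemma graphfunM k (f g : k.-tuple G -> R) :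
  graphfun f -> graphfun g -> graphfun (fun t => f t * g t).
Proof.
move=> [s fE] [r gE].
exists [seq (p.1 * q.1, glue p.2 q.2) | p <- s, q <- r] => t.
rewrite big_allpairs_dep fE gE mulr_suml; apply: eq_bigr => p _.
by rewrite mulr_sumr; apply: eq_bigr => q _; rewrite lhom_glue mulrACA.
Qed.

Lemma lhom_labeled k (t : k.-tuple G) (H : mgraph (lnode k 0)) :
  let psi := ffun0 (card_ord 0) : {ffun 'I_0 -> G} in
  lhom t (Tagged (fun n => mgraph (lnode k n)) H)
  = \prod_(e <- edges H) edgew G (labmap t psi e.1) (labmap t psi e.2).
Proof.
move=> psi; rewrite /lhom /= (bigD1 psi) //= [X in _ + X]big1 ?addr0 => [|phi].
  by rewrite big_ord0 mul1r.
by case/eqP; apply/ffunP => -[].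
Qed.

Lemma graphfun_cst k c : graphfun (fun _ : k.-tuple G => c).
Proof.
pose H := @MGraph (lnode k 0) [::] isT.
exists [:: (c, Tagged (fun n => mgraph (lnode k n)) H)] => t.
by rewrite big_seq1 lhom_labeled big_nil mulr1.
Qed.

Lemma graphfun_edge k (i j : 'I_k) : i != j ->
  graphfun (fun t => edgew G (tnth t i) (tnth t j)).
Proof.
move=> ij.
have loopless : all (fun e => e.1 != e.2) [:: (inl i, inl j) : lnode k 0 * lnode k 0].
  by rewrite /= andbT; apply: contra ij => /eqP[->].
exists [:: (1, Tagged (fun n => mgraph (lnode k n)) (MGraph loopless))] => t.
by rewrite big_seq1 mul1r lhom_labeled big_seq1.
Qed.

Section Unlabel.
Variables (k : nat) (F : lgraph k.+1).

(** The label [ord0] is erased: its node becomes the first unlabeled node, and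
the other labels and unlabeled nodes are renumbered accordingly. *)
Definition unlabel_node (x : lnode k.+1 (tag F)) : lnode k (tag F).+1 :=
  match x with
  | inl i => if unlift ord0 i is Some i' then inl i' else inr ord0
  | inr j => inr (lift ord0 j)
  end.

Lemma unlabel_node_inj : injective unlabel_node.
Proof.
case=> [i|j] [i'|j'] /=.
- by case: unliftP => [a ->|->]; case: unliftP => [b ->|->] // [->].
- by case: unliftP => [a _|_] //= [/eqP]; rewrite (negPf (neq_lift _ _)).
- by case: unliftP => [a _|_] //= [/eqP]; rewrite eq_sym (negPf (neq_lift _ _)).
- by case=> /addnI e; congr inr; apply: val_inj.
Qed.

Definition unlabel_edges := [seq (unlabel_node e.1, unlabel_node e.2) | e <- edges (tagged F)].

Lemma unlabel_loopless : all (fun e => e.1 != e.2) unlabel_edges.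
Proof.
rewrite all_map; apply: sub_all (edges_loopless (tagged F)) => e /=.
by rewrite (inj_eq unlabel_node_inj).
Qed.

Definition unlabel : lgraph k :=
  Tagged (fun n => mgraph (lnode k n)) (MGraph unlabel_loopless).

Lemma lhom_unlabel (t : k.-tuple G) :
  lhom t unlabel = \sum_v nodew G v * lhom [tuple of v :: t] F.
Proof.
under [RHS]eq_bigr do rewrite mulr_sumr.
rewrite pair_big /lhom /=.
rewrite (reindex (fun p : G * {ffun 'I_(tag F) -> G} =>
  [ffun j => if unlift ord0 j is Some j' then p.2 j' else p.1])) /=.
  apply: eq_bigr => -[v psi] _ /=; set phi := [ffun j => _].
  have phi0 : phi ord0 = v by rewrite ffunE unlift_none.
  have phiS j : phi (lift ord0 j) = psi j by rewrite ffunE liftK.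
  rewrite big_ord_recl phi0 mulrA; congr (_ * _ * _).
    by apply: eq_bigr => j _; rewrite phiS.
  have lab x : labmap t phi (unlabel_node x) = labmap [tuple of v :: t] psi x.
    case: x => [i|j] //=.
    by case: unliftP => [a ->|->] /=; rewrite ?tnthS ?tnth0.
  by rewrite big_map; apply: eq_bigr => e _; rewrite !lab.
exists (fun phi : {ffun 'I_(tag F).+1 -> G} =>
  (phi ord0, [ffun j => phi (lift ord0 j)])) => [[v psi]|phi] _ /=.
  rewrite ffunE unlift_none; congr (_, _).
  by apply/ffunP => j; rewrite !ffunE liftK.
by apply/ffunP => j; rewrite !ffunE; case: unliftP => [a ->|->]; rewrite ?ffunE.
Qed.

End Unlabel.

(** Integrating out one coordinate preserves the span, since it is realized on
graphs by erasing a label. *)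
Lemma graphfun_sum_head k (f : k.+1.-tuple G -> R) : graphfun f ->
  graphfun (fun t : k.-tuple G => \sum_v nodew G v * f [tuple of v :: t]).
Proof.
move=> [s fE]; exists [seq (p.1, unlabel p.2) | p <- s] => t.
under eq_bigr do rewrite fE mulr_sumr.
rewrite exchange_big big_map /=; apply: eq_bigr => p _.
by rewrite lhom_unlabel mulr_sumr; apply: eq_bigr => v _; rewrite mulrCA.
Qed.

(** * Indistinguishable tuples *)

Definition indist k (t u : k.-tuple G) : Prop := forall F, lhom t F = lhom u F.

Lemma indist_sym k (t u : k.-tuple G) : indist t u -> indist u t.
Proof. by move=> tu F; rewrite tu. Qed.

Lemma indist_graphfun k (t u : k.-tuple G) f :
  indist t u -> graphfun f -> f t = f u.
Proof. by move=> tu [s fE]; rewrite !fE; apply: eq_bigr => p _; rewrite tu. Qed.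

Lemma graphfun_prod k I (r : seq I) (f : I -> k.-tuple G -> R) :
  (forall i, graphfun (f i)) -> graphfun (fun t => \prod_(i <- r) f i t).
Proof.
move=> gf; elim: r => [|i r IH].
  by have [s sE] := graphfun_cst k 1; exists s => t; rewrite big_nil -sE.
have [s sE] := graphfunM (gf i) IH.
by exists s => t; rewrite big_cons sE.
Qed.

(** Interpolation: every tuple [v] outside the class of [t] is separated from
[t] by some graph, so a function of the span takes the value 1 at [t] and 0 at
[v]; the product of all these is the indicator of the class. *)
Lemma graphfun_class k (t : k.-tuple G) : graphfun (fun u => (`[< indist u t >])%:R).
Proof.
have /choice[f] : forall v : k.-tuple G, exists f,
    [/\ graphfun f, f t = 1 & ~ indist v t -> f v = 0].
  move=> v; case: (pselect (indist v t)) => [vt|nvt].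
    by exists (fun=> 1); split=> //; apply: graphfun_cst.
  have /existsNP[F /eqP neF] := nvt.
  exists (fun u => (lhom t F - lhom v F)^-1 * (lhom u F + - lhom v F)); split.
  - apply: graphfunZ; apply: graphfunD; first exact: graphfun_lhom.
    exact: graphfun_cst.
  - by rewrite mulVf // subr_eq0 eq_sym.
  - by rewrite subrr mulr0.
move=> fP; have gf : graphfun (fun u => \prod_(v : k.-tuple G) f v u).
  by apply: graphfun_prod => v; case: (fP v).
have [s sE] := gf; exists s => u; rewrite -sE.
case: asboolP => [ut|nut].
  by rewrite (indist_graphfun ut gf) big1 // => v _; case: (fP v).
have [_ _ /(_ nut) fu0] := fP u.
by rewrite (bigD1 u) //= fu0 mul0r.
Qed.

Lemma indist_sum_class k (t u : k.-tuple G) (w : k.+1.-tuple G) : indist t u ->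
  \sum_v nodew G v * (`[< indist [tuple of v :: t] w >])%:R
  = \sum_v nodew G v * (`[< indist [tuple of v :: u] w >])%:R :> R.
Proof.
move=> tu.
exact: (indist_graphfun tu (graphfun_sum_head (graphfun_class w))).
Qed.

(** Back and forth: the total weight of the nodes extending [t] within the
class of [v :: t] is positive, and it is the same for [u]. *)
Lemma indist_extend k (t u : k.-tuple G) v : indist t u ->
  exists v', indist [tuple of v :: t] [tuple of v' :: u].
Proof.
move=> tu; apply: contrapT => /forallNP no.
have /eqP := indist_sum_class [tuple of v :: t] tu.
rewrite [X in _ == X]big1 => [|v' _]; last first.
  by case: asboolP => [ind|_]; rewrite ?mulr0 //; case: (no v') => F; rewrite ind.
rewrite gt_eqF // (bigD1 v) //= asboolT // mulr1 ltr_wpDr ?nodew_gt0 //.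
by apply: sumr_ge0 => v' _; rewrite mulr_ge0 ?ler0n // ltW ?nodew_gt0.
Qed.

Lemma indist_edge k (t u : k.-tuple G) i j : i != j -> indist t u ->
  edgew G (tnth t i) (tnth t j) = edgew G (tnth u i) (tnth u j).
Proof. by move=> ij tu; apply: (indist_graphfun tu (graphfun_edge ij)). Qed.

(** * Indistinguishable tuples are automorphic in a twin-free graph *)

Hypothesis G_twin_free : twin_free G.

(** A node [l] that would witness that [u_i] and [u_j] are not twins can be
matched by an extension of [t], where it sees [t_i = t_j]. *)
Lemma indist_eq k (t u : k.-tuple G) i j : indist t u ->
  tnth t i = tnth t j -> tnth u i = tnth u j.
Proof.
move=> tu tij; apply: G_twin_free => l.
have [l' lP] := indist_extend l (indist_sym tu).
have E a := indist_edge (neq_lift ord0 a) lP.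
have := E i; have := E j; rewrite !tnthS !tnth0 tij => Ej Ei.
by rewrite [LHS]edgewC [RHS]edgewC Ei Ej.
Qed.

(** Any finite list of nodes can be added to [t]; the map [f] locates the
original coordinates, which spares casts between lengths of tuples. *)
Lemma indist_surj k (t u : k.-tuple G) (s : seq G) : indist t u ->
  exists m (t' u' : m.-tuple G) (f : 'I_k -> 'I_m),
   [/\ indist t' u', (forall i, tnth t' (f i) = tnth t i),
       (forall i, tnth u' (f i) = tnth u i)
     & forall v, v \in s -> exists i, tnth t' i = v].
Proof.
move=> tu; elim: s => [|v s [m [t' [u' [f [tu' ft fu sP]]]]]].
  by exists k, t, u, id; split.
have [v' vP] := indist_extend v tu'.
exists m.+1, [tuple of v :: t'], [tuple of v' :: u'], (fun i => lift ord0 (f i)).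
split=> // [i|i|x]; rewrite ?tnthS // in_cons => /orP[/eqP->|/sP[i <-]].
  by exists ord0; rewrite tnth0.
by exists (lift ord0 i); rewrite tnthS.
Qed.

Lemma indist_head_eq k (t u : k.-tuple G) i v :
  indist [tuple of tnth t i :: t] [tuple of v :: u] -> v = tnth u i.
Proof.
move=> ind; have := indist_eq (i := ord0) (j := lift ord0 i) ind.
by rewrite !tnth0 !tnthS; apply.
Qed.

Lemma indist_repeat k (t u : k.-tuple G) i : indist t u ->
  indist [tuple of tnth t i :: t] [tuple of tnth u i :: u].
Proof.
by move=> tu; have [v ind] := indist_extend (tnth t i) tu;
  rewrite -(indist_head_eq ind).
Qed.

(** Both weights are the same sum over the class of the tuple that repeats
[t_i]: equality of coordinates leaves a single node in this sum. *)
Lemma indist_nodew k (t u : k.-tuple G) i : indist t u ->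
  nodew G (tnth t i) = nodew G (tnth u i).
Proof.
move=> tu; pose w := [tuple of tnth t i :: t].
have pinned (x : k.-tuple G) : indist t x ->
    \sum_v nodew G v * (`[< indist [tuple of v :: x] w >])%:R
    = nodew G (tnth x i).
  move=> tx; rewrite (bigD1 (tnth x i)) //= asboolT ?mulr1; last first.
    exact: indist_sym (indist_repeat i tx).
  rewrite big1 ?addr0 // => v /eqP ne.
  by case: asboolP => [/indist_sym/indist_head_eq/ne|_]; last rewrite mulr0.
by rewrite -(pinned t) // -(pinned u) //; apply: indist_sum_class.
Qed.

(** Repeating [t_i] in a new position reaches the case [i = j], which no
loopless graph on the labels can test directly. *)
Lemma indist_edgew k (t u : k.-tuple G) i j : indist t u ->
  edgew G (tnth t i) (tnth t j) = edgew G (tnth u i) (tnth u j).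
Proof.
move=> tu; have := indist_edge (neq_lift ord0 j) (indist_repeat i tu).
by rewrite !tnth0 !tnthS.
Qed.

Lemma indist_Aut k (t u : k.-tuple G) : indist t u ->
  exists2 s, s \in wg_Aut G & n_act 'P t s = u.
Proof.
move=> tu; have [m [t' [u' [f [tu' ft fu surj]]]]] := indist_surj (enum G) tu.
have /choice[g gK] : forall v, exists i, tnth t' i = v.
  by move=> v; apply: surj; rewrite mem_enum.
have sigma_inj : injective (fun v => tnth u' (g v)).
  by move=> v w /(indist_eq (indist_sym tu')); rewrite !gK.
have sE i : perm sigma_inj (tnth t' i) = tnth u' i.
  by rewrite permE; apply: (indist_eq tu'); rewrite gK.
exists (perm sigma_inj).
  rewrite inE; apply/andP; split; apply/forallP => v.
    by rewrite -(gK v) sE (indist_nodew _ tu').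
  apply/forallP => w.
  by rewrite -(gK v) -(gK w) !sE (indist_edgew _ _ tu').
by apply: eq_from_tnth => i; rewrite tnth_map -ft -fu /= /aperm sE.
Qed.

Lemma lhom_Aut k (t : k.-tuple G) s F : s \in wg_Aut G ->
  lhom (n_act 'P t s) F = lhom t F.
Proof.
rewrite inE => /andP[/forallP sa /forallP sb].
rewrite /lhom (reindex (fun psi : {ffun 'I_(tag F) -> G} => [ffun j => s (psi j)])).
  apply: eq_bigr => psi _; congr (_ * _).
    by apply: eq_bigr => j _; rewrite ffunE (eqP (sa _)).
  have lab x : labmap (n_act 'P t s) [ffun j => s (psi j)] x = s (labmap t psi x).
    by case: x => [i|j] /=; rewrite ?tnth_map ?ffunE.
  by apply: eq_bigr => e _; rewrite !lab (eqP (forallP (sb _) _)).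
exists (fun psi : {ffun 'I_(tag F) -> G} => [ffun j => (s^-1)%g (psi j)]) => psi _;
  by apply/ffunP => j; rewrite !ffunE ?permK ?permKV.
Qed.

Lemma indist_orbit k (t u : k.-tuple G) :
  indist t u <-> t \in orbit ('P * k)%act (wg_Aut G) u.
Proof.
split=> [/indist_sym /indist_Aut[s sA <-]|/orbitP[s sA <-] F].
  by apply/orbitP; exists s.
exact: lhom_Aut.
Qed.

(** * From the span to the rank *)

Lemma lin_span_mem (V : lmodType R) (S : set V) v : S v -> lin_span S v.
Proof.
move=> Sv; exists 1%N, (fun=> 1), (fun=> v); split=> //.
by rewrite big_ord1 scale1r.
Qed.

Lemma lin_span0 (V : lmodType R) (S : set V) : lin_span S 0.
Proof. by exists 0%N, (fun=> 0), (fun=> 0); split; [case | rewrite big_ord0]. Qed.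

Lemma lin_spanZD (V : lmodType R) (S : set V) a v w :
  lin_span S v -> lin_span S w -> lin_span S (a *: v + w).
Proof.
move=> [n [c [x [Sx ->]]]] [m [d [y [Sy ->]]]].
exists (n + m)%N,
  (fun i => match fintype.split i with inl j => a * c j | inr j => d j end),
  (fun i => match fintype.split i with inl j => x j | inr j => y j end).
split=> [i|]; first by case: fintype.split.
rewrite big_split_ord scaler_sumr; congr (_ + _); apply: eq_bigr => i _ /=.
  by rewrite (unsplitK (inl i)) scalerA.
by rewrite (unsplitK (inr i)).
Qed.

Lemma lin_span_sum (V : lmodType R) (S : set V) (I : Type) (r : seq I)
    (c : I -> R) (w : I -> V) :
  (forall i, lin_span S (w i)) -> lin_span S (\sum_(i <- r) c i *: w i).
Proof.
move=> Sw; elim: r => [|i r IH]; first by rewrite big_nil; apply: lin_span0.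
by rewrite big_cons; apply: lin_spanZD.
Qed.

Lemma lin_span_sub (V : lmodType R) (S T : set V) :
  (S `<=` lin_span T)%classic -> (lin_span S `<=` lin_span T)%classic.
Proof.
by move=> ST _ [n [c [w [Sw ->]]]]; apply: lin_span_sum => i; apply: ST.
Qed.

(** The inner product of [f] with all graph functions; the columns of the
connection matrix are its values at the functions [lhom _ F]. *)
Definition pairing k (f : k.-tuple G -> R) (x : isotype k) : R^o :=
  \sum_t tweight t * f t * lhom t (generic_quotient.repr x).

Lemma conn_mx_column k (F : lgraph k) :
  (fun x => conn_mx G x (\pi_(isotype k)%qT F) : R^o) = pairing (fun t => lhom t F).
Proof.
apply/funext => x; rewrite /conn_mx hom_glue; apply: eq_bigr => t _.
by rewrite lhom_repr mulrAC.
Qed.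

Lemma pairing_sum k (I : Type) (r : seq I) (c : I -> R) (f : I -> k.-tuple G -> R) :
  pairing (fun t => \sum_(i <- r) c i * f i t) = \sum_(i <- r) c i *: pairing (f i).
Proof.
apply/funext => x; rewrite fct_sumE /pairing.
under eq_bigr do rewrite mulr_sumr mulr_suml.
rewrite exchange_big /=; apply: eq_bigr => i _.
rewrite [RHS]mulr_sumr; apply: eq_bigr => t _.
by rewrite [tweight t * _]mulrCA !mulrA.
Qed.

(** The form is positive definite on the span: a function of the span
orthogonal to all graphs is orthogonal to itself. *)
Lemma pairing_eq0 k (f : k.-tuple G -> R) : graphfun f -> pairing f = 0 ->
  forall t, f t = 0.
Proof.
move=> [s fE] f0 t.
have /psumr_eq0P : \sum_t tweight t * f t ^+ 2 = 0.
  transitivity (\sum_(p <- s) p.1 * pairing f (\pi_(isotype k)%qT p.2)).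
    under [RHS]eq_bigr do rewrite mulr_sumr.
    rewrite exchange_big /=; apply: eq_bigr => u _.
    rewrite expr2 mulrA [X in _ * X]fE mulr_sumr; apply: eq_bigr => p _.
    by rewrite lhom_repr mulrCA.
  by rewrite f0 big1 // => p _; rewrite mulr0.
move=> /(_ (fun u _ => mulr_ge0 (ltW (tweight_gt0 u)) (sqr_ge0 _))).
move=> /(_ t isT)/eqP.
by rewrite mulf_eq0 gt_eqF ?tweight_gt0 //= sqrf_eq0 => /eqP.
Qed.

(** The basis of the column space consists of the pairings with the indicators
of the orbits: these lie in the span, and a graph function is constant on
orbits, hence a combination of them. *)
Lemma has_rank_orb k : has_rank (@conn_mx R k G) (orb G k).
Proof.
pose orbs := orbit ('P * k)%act (wg_Aut G) @: [set: k.-tuple G].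
pose ind (O : 'I_(orb G k)) (t : k.-tuple G) : R := (t \in (enum_val O : {set _}))%:R.
have /choice[rep repE] : forall O : 'I_(orb G k), exists t,
    enum_val O = orbit ('P * k)%act (wg_Aut G) t.
  by move=> O; have /imsetP[t _ ->] := enum_valP O; exists t.
have mem_orb O t : (t \in (enum_val O : {set _})) <-> indist t (rep O).
  by rewrite repE; split=> /indist_orbit.
have ind_graphfun O : graphfun (ind O).
  have [s sE] := graphfun_class (rep O); exists s => t; rewrite -sE /ind.
  by congr (nat_of_bool _)%:R; apply/idP/asboolP => /mem_orb.
(* [o t] is the index of the orbit of [t]. *)
have /choice[o oP] : forall t, exists O, forall O', ind O' t = (O == O')%:R.
  move=> t; have orbt : orbit ('P * k)%act (wg_Aut G) t \in orbs by apply: imset_f.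
  exists (enum_rank_in orbt (orbit ('P * k)%act (wg_Aut G) t)) => O'.
  congr (nat_of_bool _)%:R; apply/idP/eqP => [|<-].
    rewrite repE => /orbit_eqP E; apply: enum_val_inj.
    by rewrite enum_rankK_in // E repE.
  by rewrite enum_rankK_in // orbit_refl.
have o_rep O : o (rep O) = O.
  apply/eqP; have := oP (rep O) O; rewrite /ind (mem_orb _ _).2 //.
  by case: (o (rep O) == O) => // /eqP; rewrite oner_eq0.
exists (fun O => pairing (ind O)); split.
  move=> c; rewrite -pairing_sum => c0 O.
  have /pairing_eq0/(_ c0 (rep O)) : graphfun (fun t => \sum_O' c O' * ind O' t).
    by apply: graphfun_sum => O'; apply: graphfunZ.
  rewrite (bigD1 O) //= big1 => [|O' /negPf ne].
    by rewrite oP o_rep eqxx mulr1 addr0.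
  by rewrite oP o_rep eq_sym ne mulr0.
apply/seteqP; split; apply: lin_span_sub.
  move=> _ [y _ <-]; rewrite -(generic_quotient.reprK y) conn_mx_column.
  set F := generic_quotient.repr y.
  have -> : (fun t => lhom t F) = (fun t => \sum_O lhom (rep O) F * ind O t).
    apply/funext => t; rewrite (bigD1 (o t)) //= big1 => [|O /negPf ne].
      rewrite addr0 oP eqxx mulr1.
      suff /mem_orb : t \in (enum_val (o t) : {set _}) by apply.
      have := oP t (o t); rewrite eqxx /ind; case: (t \in _) => // /eqP.
      by rewrite eq_sym oner_eq0.
    by rewrite oP eq_sym ne mulr0.
  rewrite pairing_sum; apply: lin_span_sum => O.
  by apply: lin_span_mem; exists O.
move=> _ [O _ <-]; have [s sE] := ind_graphfun O.
rewrite (_ : ind O = fun t => \sum_(p <- s) p.1 * lhom t p.2); last exact/funext.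
rewrite pairing_sum; apply: lin_span_sum => p; apply: lin_span_mem.
by exists (\pi_(isotype k)%qT p.2); rewrite // conn_mx_column.
Qed.

End ConnectionRank.

Theorem theorem2p2 (R : realType) (G : wgraph R) (hG : twin_free G) (k : nat) :
  has_rank (@conn_mx R k G) (orb G k).
Proof. exact: has_rank_orb. Qed.
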